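(* Consider $n$ agents indexed by $\mathcal{V}=\{1,\dots,n\}$ with Lagrangian dynamics $$M_i(q_i)\ddot q_i+C_i(q_i,\dot q_i)\dot q_i=\tau_i,\qquad i\in\mathcal{V},$$ where $q_i\in\mathbb{R}^m$, and for each $i$: $M_i(q_i)$ is symmetric positive definite and bounded for all $q_i$; $\dot M_i(q_i)-2C_i(q_i,\dot q_i)$ is skew symmetric; and there is $k_C>0$ with $\|C_i(q_i,\dot q_i)\|\le k_C\|\dot q_i\|$, $C_i$ bounded in $q_i$. Let $\mathcal{X}_1,\dots,\mathcal{X}_n\subseteq\mathbb{R}^m$ be closed convex sets such that $\mathcal{X}_0=\bigcap_{i=1}^n\mathcal{X}_i$ is nonempty and bounded. Let $\mathcal{G}=(\mathcal{V},\mathcal{E})$ be a fixed undirected graph with neighbor sets $\mathcal{N}_i=\{j:\{j,i\}\in\mathcal{E}\}$ and weights $a_{ij}=a_{ji}>0$ for $\{j,i\}\in\mathcal{E}$. Apply the control $$\tau_i=-k\dot q_i-(q_i-P_{\mathcal{X}_i}(q_i))-\sum_{j\in\mathcal{N}_i}a_{ij}(q_i-q_j),\qquad i\in\mathcal{V},$$ with $k>0$. If $\mathcal{G}$ is connected, then the closed-loop system achieves cooperative set aggregation: for every solution, $\lim_{t\to\infty}\|q_i(t)\|_{\mathcal{X}_0}=0$ for all $i$, $\lim_{t\to\infty}(q_i(t)-q_j(t))=0$ for all $i,j$, and $\lim_{t\to\infty}\dot q_i(t)=0$ for all $i$.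
   Context: $\|\cdot\|$ is the Euclidean norm. For a nonempty set $\mathcal{S}\subseteq\mathbb{R}^m$, $\|x\|_{\mathcal{S}}=\inf_{y\in\mathcal{S}}\|x-y\|$. For a closed convex set $\mathcal{S}$, $P_{\mathcal{S}}(x)\in\mathcal{S}$ denotes the Euclidean projection of $x$ onto $\mathcal{S}$, i.e. the point with $\|x-P_{\mathcal{S}}(x)\|=\|x\|_{\mathcal{S}}$. A graph is connected if every pair of nodes is joined by a path. *)

(* Defs.v *)
From HB Require Import structures.
From mathcomp Require Import all_boot all_order all_algebra.
From mathcomp Require Import all_classical all_reals all_analysis.
Set Implicit Arguments. Unset Strict Implicit. Unset Printing Implicit Defensive.
Import Order.TTheory GRing.Theory Num.Theory.
Import numFieldNormedType.Exports.
Local Open Scope classical_set_scope.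
Local Open Scope ring_scope.

Definition enorm {R : realType} {m : nat} (x : 'cV[R]_m) : R :=
  Num.sqrt (\sum_(i < m) (x i 0) ^+ 2).

Definition dist_to_set {R : realType} {m : nat} (S : set 'cV[R]_m) (x : 'cV[R]_m) : R :=
  inf [set enorm (x - y) | y in S].

Definition is_convex_set {R : realType} {m : nat} (S : set 'cV[R]_m) : Prop :=
  forall x y (t : R), S x -> S y -> 0 <= t -> t <= 1 ->
    S (t *: x + (1 - t) *: y).

Definition ebounded_set {R : realType} {m : nat} (S : set 'cV[R]_m) : Prop :=
  exists r : R, forall x, S x -> enorm x <= r.

Definition is_projection {R : realType} {m : nat} (S : set 'cV[R]_m)
  (P : 'cV[R]_m -> 'cV[R]_m) : Prop :=
  forall x, S (P x) /\ enorm (x - P x) = dist_to_set S x.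

Definition graph_connected {n : nat} (e : rel 'I_n) : Prop :=
  forall i j, connect e i j.

Definition common_set {R : realType} {n m : nat} (X : 'I_n -> set 'cV[R]_m)
  : set 'cV[R]_m := \bigcap_(i in [set: 'I_n]) X i.

(* Main.v *)
Require Import Defs.
From HB Require Import structures.
From mathcomp Require Import all_boot all_order all_algebra.
From mathcomp Require Import all_classical all_reals all_analysis.
From mathcomp Require Import ring lra.
Import Order.TTheory GRing.Theory Num.Theory.
Import numFieldNormedType.Exports.
Local Open Scope classical_set_scope.
Local Open Scope ring_scope.

(* The energy V, the sum of the kinetic energies, of half the squared distances
   |q_i - P_i q_i|^2 and of the quadratic coupling potentials, satisfies
   V' = -k sum |dq_i|^2.  Boundedness of V bounds the disagreements and the
   distances to the X_i; since X_0 is bounded, this bounds the q_i, and then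
   positive definiteness of the inertia on bounded sets bounds the dq_i.  The
   total kinetic energy K is Lipschitz in time and V' <= -c K, so K -> 0 and
   dq_i -> 0.  The momenta M_i dq_i then tend to 0 while their derivatives
   differ by o(1) from the static forces, which are Lipschitz in time: hence
   the static forces tend to 0.  Pairing them with q_i - x0 for a point x0 of
   X_0 shows that |q_i - P_i q_i| and q_i - q_j tend to 0, and a compactness
   argument gives the convergence of the distances to X_0. *)

(** * Euclidean geometry *)

Definition dot {R : realType} {m : nat} (x y : 'cV[R]_m) : R :=
  \sum_(i < m) x i 0 * y i 0.

Section euclidean.
Context {R : realType} {m : nat}.
Implicit Types (x y z : 'cV[R]_m) (c : R).

Lemma dotC x y : dot x y = dot y x.
Proof. by apply: eq_bigr => i _; rewrite mulrC. Qed.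

Lemma dotDl x y z : dot (x + y) z = dot x z + dot y z.
Proof. by rewrite -big_split; apply: eq_bigr => i _; rewrite mxE mulrDl. Qed.

Lemma dotZl c x y : dot (c *: x) y = c * dot x y.
Proof. by rewrite mulr_sumr; apply: eq_bigr => i _; rewrite mxE mulrA. Qed.

Lemma dotNl x y : dot (- x) y = - dot x y.
Proof. by rewrite -scaleN1r dotZl mulN1r. Qed.

Lemma dotBl x y z : dot (x - y) z = dot x z - dot y z.
Proof. by rewrite dotDl dotNl. Qed.

Lemma dotDr x y z : dot z (x + y) = dot z x + dot z y.
Proof. by rewrite dotC dotDl !(dotC z). Qed.

Lemma dotZr c x y : dot x (c *: y) = c * dot x y.
Proof. by rewrite dotC dotZl dotC. Qed.

Lemma dotNr x y : dot x (- y) = - dot x y.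
Proof. by rewrite dotC dotNl dotC. Qed.

Lemma dotBr x y z : dot z (x - y) = dot z x - dot z y.
Proof. by rewrite dotDr dotNr. Qed.

Lemma dot0l x : dot 0 x = 0.
Proof. by rewrite /dot big1// => i _; rewrite mxE mul0r. Qed.

Lemma dot_suml n (f : 'I_n -> 'cV[R]_m) x :
  dot (\sum_(i < n) f i) x = \sum_(i < n) dot (f i) x.
Proof.
by apply: (big_morph (dot^~ x)) => [u v|]; rewrite ?dotDl ?dot0l.
Qed.

Lemma dot_mulmxr (A : 'M[R]_m) x y : dot x (A *m y) = (x^T *m A *m y) 0 0.
Proof.
by rewrite -mulmxA [in RHS]mxE; apply: eq_bigr => i _; rewrite [x^T _ _]mxE.
Qed.

Lemma dot_trmx (A : 'M[R]_m) x y : dot x (A^T *m y) = dot (A *m x) y.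
Proof.
rewrite dot_mulmxr -trmx_mul mxE; apply: eq_bigr => i _.
by rewrite [_^T _ _]mxE.
Qed.

Lemma dot_ge0 x : 0 <= dot x x.
Proof. by apply: sumr_ge0 => i _; rewrite -expr2 sqr_ge0. Qed.

Lemma enorm_sq x : enorm x ^+ 2 = dot x x.
Proof.
rewrite sqr_sqrtr; first by apply: eq_bigr => i _; rewrite expr2.
by apply: sumr_ge0 => i _; rewrite sqr_ge0.
Qed.

Lemma enorm_ge0 x : 0 <= enorm x.
Proof. exact: sqrtr_ge0. Qed.

Lemma enorm_le_sq x c : 0 <= c -> (enorm x <= c) = (dot x x <= c ^+ 2).
Proof. by move=> c0; rewrite -enorm_sq ler_pXn2r// ?nnegrE ?enorm_ge0. Qed.

Lemma enormZ c x : enorm (c *: x) = `|c| * enorm x.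
Proof.
apply/eqP; rewrite -(@eqrXn2 _ 2)// ?enorm_ge0 ?mulr_ge0 ?enorm_ge0//.
by rewrite exprMn !enorm_sq dotZl dotZr real_normK ?num_real// expr2 mulrA.
Qed.

Lemma enormN x : enorm (- x) = enorm x.
Proof. by rewrite -scaleN1r enormZ normrN1 mul1r. Qed.

Lemma enormBC x y : enorm (x - y) = enorm (y - x).
Proof. by rewrite -enormN opprB. Qed.

Lemma enorm0 : enorm (0 : 'cV[R]_m) = 0.
Proof. by rewrite /enorm big1 ?sqrtr0// => i _; rewrite mxE expr0n. Qed.

Lemma coord_le_enorm x i : `|x i 0| <= enorm x.
Proof.
rewrite -ler_sqr ?nnegrE ?enorm_ge0// enorm_sq real_normK ?num_real//.
rewrite /dot (bigD1 i)//= -expr2 lerDl.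
by apply: sumr_ge0 => j _; rewrite -expr2 sqr_ge0.
Qed.

Lemma enorm0_eq0 x : enorm x = 0 -> x = 0.
Proof.
move=> x0; apply/colP => i; rewrite mxE; apply/eqP.
by rewrite -normr_le0 -x0 coord_le_enorm.
Qed.

Lemma cauchy_schwarz x y : dot x y <= enorm x * enorm y.
Proof.
have [->|x0] := eqVneq x 0; first by rewrite dot0l mulr_ge0 ?enorm_ge0.
have xx : 0 < dot x x.
  rewrite lt_def dot_ge0 andbT -enorm_sq sqrf_eq0.
  by apply: contra x0 => /eqP/enorm0_eq0 ->.
apply: le_trans (ler_norm _) _.
rewrite -ler_sqr ?nnegrE ?mulr_ge0 ?enorm_ge0//.
rewrite exprMn !enorm_sq real_normK ?num_real//.
(* This vector is [dot x x] times the component of [y] orthogonal to [x]; its squared length is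
   [a * (a * c - b ^+ 2)]. *)
have := dot_ge0 (dot x x *: y - dot x y *: x).
rewrite dotBl !dotBr !dotZl !dotZr (dotC y x).
set b := dot x y; set a := dot x x in xx *; set c := dot y y => H.
have : 0 <= a * (a * c - b ^+ 2) by lra.
by rewrite pmulr_rge0// subr_ge0.
Qed.

Lemma cauchy_schwarz_norm x y : `|dot x y| <= enorm x * enorm y.
Proof.
by rewrite ler_norml cauchy_schwarz andbT lerNl -dotNl -(enormN x) cauchy_schwarz.
Qed.

Lemma enormD x y : enorm (x + y) <= enorm x + enorm y.
Proof.
rewrite enorm_le_sq ?addr_ge0 ?enorm_ge0//.
rewrite dotDl !dotDr (dotC y x) sqrrD !enorm_sq.
have := cauchy_schwarz x y; lra.
Qed.

Lemma enormB x y : enorm (x - y) <= enorm x + enorm y.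
Proof. by rewrite -(enormN y) enormD. Qed.

Lemma enorm_sum n (f : 'I_n -> 'cV[R]_m) :
  enorm (\sum_j f j) <= \sum_j enorm (f j).
Proof.
elim/big_ind2: _ => [|x r y s xr ys|//]; first by rewrite enorm0.
by rewrite (le_trans (enormD _ _))// lerD.
Qed.

Lemma enorm_dist x y z : enorm (x - z) <= enorm (x - y) + enorm (y - z).
Proof. by rewrite -[x - z](subrKA y) enormD. Qed.

Lemma enorm_le_sum x : enorm x <= \sum_(i < m) `|x i 0|.
Proof.
have s0 : 0 <= \sum_(i < m) `|x i 0| by apply: sumr_ge0.
rewrite enorm_le_sq// expr2 mulr_suml; apply: ler_sum => i _.
rewrite (le_trans (ler_norm _))// normrM ler_wpM2l//.
by rewrite (bigD1 i)//= lerDl sumr_ge0.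
Qed.

(** With [y = A^T x], the square of [enorm y] is [dot (A *m y) x], at most [c * enorm y * enorm x].
    The momentum derivative contains the transpose of the Coriolis matrix, while the assumed bound
    concerns the matrix itself. *)
Lemma enorm_trmx_mulmx_le (A : 'M[R]_m) c x : 0 <= c ->
  (forall y, enorm (A *m y) <= c * enorm y) -> enorm (A^T *m x) <= c * enorm x.
Proof.
move=> c0 Ac; set y := A^T *m x.
have [y0|y0] := eqVneq (enorm y) 0.
  by rewrite y0 mulr_ge0 ?enorm_ge0.
have yp : 0 < enorm y by rewrite lt_def y0 enorm_ge0.
rewrite -(ler_pM2l yp) -expr2 enorm_sq {2}/y dot_trmx.
apply: le_trans (cauchy_schwarz _ _) _.
by rewrite mulrA (mulrC (enorm y)) ler_wpM2r ?enorm_ge0.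
Qed.

End euclidean.

(** * Projection onto a convex set *)

Section projection.
Context {R : realType} {m : nat}.
Implicit Types (S : set 'cV[R]_m) (x y z : 'cV[R]_m).

(** To first order in [s], the squared length of [d - s *: u] changes by [- 2 * s * dot d u], so a
    positive product would shorten [d] for small [s]. *)
Lemma dot_le0_of_segment (d u : 'cV[R]_m) :
  (forall s, 0 <= s -> s <= 1 -> dot d d <= dot (d - s *: u) (d - s *: u)) ->
  dot d u <= 0.
Proof.
move=> H; rewrite leNgt; apply/negP; set c := dot d u => c0.
have uu := dot_ge0 u.
have cu : 0 < c + dot u u by rewrite ltr_wpDr.
(* For this [s] the term [s * dot u u] is at most [c], so it cannot reach the [2 * c] that the
   hypothesis forces. *)
pose s := c / (c + dot u u).
have s0 : 0 < s by rewrite divr_gt0.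
have s1 : s <= 1 by rewrite ler_pdivrMr// mul1r lerDl.
have {}H := H s (ltW s0) s1.
rewrite dotBl !dotBr !dotZl !dotZr (dotC u d) -/c in H.
have : s * (2 * c) <= s * (s * dot u u) by lra.
rewrite ler_pM2l// /s mulrAC ler_pdivlMr// -subr_ge0.
have -> : c * dot u u - 2 * c * (c + dot u u) = - (c * (c + (c + dot u u))).
  by ring.
by rewrite oppr_ge0 leNgt mulr_gt0// addr_gt0.
Qed.

Lemma dist_to_set_lbound S x : has_lbound [set enorm (x - y) | y in S].
Proof. by exists 0 => _ [y _ <-]; exact: enorm_ge0. Qed.

Lemma dist_to_set_le S x y : S y -> dist_to_set S x <= enorm (x - y).
Proof. by move=> Sy; apply: ge_inf; [exact: dist_to_set_lbound|exists y]. Qed.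

Lemma dist_to_set_ge0 S x : S !=set0 -> 0 <= dist_to_set S x.
Proof.
move=> [z Sz]; apply: lb_le_inf => [|_ [y _ <-]]; last exact: enorm_ge0.
by exists (enorm (x - z)), z.
Qed.

Lemma dist_to_set_lipschitz S x y : S !=set0 ->
  `|dist_to_set S x - dist_to_set S y| <= enorm (x - y).
Proof.
move=> S0.
have H u v : dist_to_set S u - dist_to_set S v <= enorm (u - v).
  rewrite lerBlDr -lerBlDl; case: (S0) => z Sz.
  apply: lb_le_inf => [|_ [w Sw <-]]; first by exists (enorm (v - z)), z.
  by rewrite lerBlDl (le_trans (dist_to_set_le _ u w Sw))// enorm_dist.
by rewrite ler_norml H andbT lerNl opprB enormBC H.
Qed.

Context (S : set 'cV[R]_m) (P : 'cV[R]_m -> 'cV[R]_m).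
Hypotheses (Sconv : is_convex_set S) (SP : is_projection S P).

Lemma projection_in x : S (P x).
Proof. by have [] := SP x. Qed.

Lemma projection_le x y : S y -> enorm (x - P x) <= enorm (x - y).
Proof. by have [_ ->] := SP x; exact: dist_to_set_le. Qed.

(** By convexity the segment from [P x] to [y] stays in [S], so none of its points is closer to [x]
    than [P x]. This is the variational inequality of the projection. *)
Lemma projection_obtuse x y : S y -> dot (x - P x) (y - P x) <= 0.
Proof.
move=> Sy; apply: dot_le0_of_segment => s s0 s1.
rewrite -!enorm_sq ler_sqr ?nnegrE ?enorm_ge0//.
have -> : x - P x - s *: (y - P x) = x - (s *: y + (1 - s) *: P x).
  by apply/matrixP => i j; rewrite !mxE; ring.
exact/projection_le/Sconv/s1/s0/projection_in.
Qed.

Lemma projection_residual_dot_ge x z : S z ->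
  dot (x - P x) (x - P x) <= dot (x - P x) (x - z).
Proof.
move=> Sz; have := projection_obtuse x _ Sz.
by rewrite !dotBr; lra.
Qed.

(** Adding the obtuse-angle inequalities at [P x] and [P y] gives firm nonexpansiveness of the
    residual map. *)
Lemma projection_residual_firm x y :
  dot ((x - P x) - (y - P y)) ((x - P x) - (y - P y)) <=
  dot ((x - P x) - (y - P y)) (x - y).
Proof.
have := projection_obtuse x _ (projection_in y).
have := projection_obtuse y _ (projection_in x).
rewrite !(dotBl, dotBr); lra.
Qed.

Lemma projection_residual_lipschitz x y :
  enorm ((x - P x) - (y - P y)) <= enorm (x - y).
Proof.
set w := (x - P x) - (y - P y).
have := le_trans (projection_residual_firm x y) (cauchy_schwarz _ _).
rewrite -/w -enorm_sq expr2.
have [->|w0] := eqVneq (enorm w) 0; first by rewrite enorm_ge0.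
by rewrite ler_pM2l// lt_def w0 enorm_ge0.
Qed.

(* Half the squared distance has gradient [x - P x]. *)
Lemma projection_sqdist_expansion x y :
  `|dot (y - P y) (y - P y) / 2 - dot (x - P x) (x - P x) / 2
    - dot (x - P x) (y - x)| <= dot (y - x) (y - x) / 2.
Proof.
have H1 := projection_obtuse x _ (projection_in y).
have H2 := projection_obtuse y _ (projection_in x).
(* With [d = x - P x] and [h = y - x], the remainder is [dot d (w - h) + dot w w / 2]. The
   obtuse-angle inequality at [P x] bounds it below by [dot w w / 2], the one at [P y] bounds it
   above by [dot h h / 2 - dot (w - h) (w - h) / 2]. *)
set w := (y - P y) - (x - P x).
have ww := dot_ge0 w.
have wh : 0 <= dot (w - (y - x)) (w - (y - x)) by exact: dot_ge0.
have E : w - (y - x) = P x - P y.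
  by rewrite /w; apply/matrixP => i j; rewrite !mxE; ring.
have Edy : y - P y = x - P x + w by rewrite /w [RHS]addrC subrK.
have Exy : P y - P x = - (w - (y - x)) by rewrite E opprB.
rewrite ler_norml; move: H1 H2; rewrite Exy -E Edy.
move: (x - P x) (y - x) w ww wh {E Edy Exy} => d h w ww wh.
have := dot_ge0 h.
rewrite !(dotDl, dotBl, dotDr, dotBr, dotNr, dotNl) in wh *.
rewrite ?(dotC w d) ?(dotC h w) ?(dotC h d) in wh * => hh H1 H2.
by apply/andP; split; lra.
Qed.

End projection.

(** * Differentiation and asymptotics in time *)

Section derivatives.
Context {R : realType}.

Lemma is_derive_mxP m n (F : R -> 'M[R]_(m, n)) (t : R) dF :
  is_derive t 1 F dF <->
  forall i j, is_derive t 1 (fun s => F s i j) (dF i j).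
Proof.
split=> [[dif <-] i j|H].
  split; first by move/derivable_mxP: dif; exact.
  by rewrite (derive_mx dif) mxE.
have dif : derivable F t 1 by apply/derivable_mxP => i j; case: (H i j).
split => //; rewrite derive_mx//; apply/matrixP => i j.
by rewrite mxE; case: (H i j).
Qed.

Lemma is_derive_fsum n (h : 'I_n -> R -> R) (t : R) (dh : 'I_n -> R) :
  (forall i, is_derive t 1 (h i) (dh i)) ->
  is_derive t 1 (fun s => \sum_(i < n) h i s) (\sum_(i < n) dh i).
Proof.
move=> H; have := @is_derive_sum _ _ _ _ h t 1 dh H.
by congr is_derive; apply/funext => s; rewrite fct_sumE.
Qed.

Lemma is_derive_mul (f g : R -> R) (t df dg : R) :
  is_derive t 1 f df -> is_derive t 1 g dg ->
  is_derive t 1 (fun s => f s * g s) (df * g t + f t * dg).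
Proof.
move=> Hf Hg; apply: (is_derive_eq (f := f * g)).
by rewrite /GRing.scale /=; ring.
Qed.

Lemma is_derive_mulmx m n p (A : R -> 'M[R]_(m, n)) (B : R -> 'M[R]_(n, p))
    (t : R) dA dB :
  is_derive t 1 A dA -> is_derive t 1 B dB ->
  is_derive t 1 (fun s => A s *m B s) (dA *m B t + A t *m dB).
Proof.
move=> /is_derive_mxP HA /is_derive_mxP HB; apply/is_derive_mxP => i j.
rewrite !mxE -big_split/=.
under eq_fun do rewrite mxE.
by apply: is_derive_fsum => k; apply: is_derive_mul.
Qed.

Lemma is_derive_dot m (f g : R -> 'cV[R]_m) (t : R) df dg :
  is_derive t 1 f df -> is_derive t 1 g dg ->
  is_derive t 1 (fun s => dot (f s) (g s)) (dot df (g t) + dot (f t) dg).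
Proof.
move=> /is_derive_mxP Hf /is_derive_mxP Hg; rewrite /dot -big_split/=.
by apply: is_derive_fsum => k; apply: is_derive_mul.
Qed.

Lemma is_derive_comp_diff m n p (f : 'M[R]_(m, n) -> 'M[R]_p)
    (g : R -> 'M[R]_(m, n)) (t : R) dg :
  differentiable f (g t) -> is_derive t 1 g dg ->
  is_derive t 1 (fun s => f (g s)) ('D_dg f (g t)).
Proof.
move=> df [/derivable1_diffP dgt <-].
have dfg := differentiable_comp dgt df.
split; first exact: diff_derivable.
rewrite [LHS]deriveE// diff_comp//= [in RHS]deriveE//.
idtac.
by rewrite deriveE.
Qed.

(** Both functions vanish at [t], so the difference quotients of [r] are dominated by those of
    [u]. *)
Lemma is_derive_dominated0 (r u : R -> R) (t : R) :
  r t = 0 -> u t = 0 -> (forall s, `|r s| <= u s) -> is_derive t 1 u 0 ->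
  is_derive t 1 r 0.
Proof.
move=> rt ut ru [du du0].
have H : (fun h => h^-1 *: ((r \o shift t) (h *: 1) - r t)) @ 0^' --> (0 : R).
  have : (fun h => h^-1 *: ((u \o shift t) (h *: 1) - u t)) @ 0^' --> (0 : R).
    by rewrite -[X in _ --> X]du0; exact: du.
  move=> /cvgr0Pnorm_le Hu; apply/cvgr0Pnorm_le => eps /Hu.
  apply: filterS => h; apply: le_trans.
  rewrite !normrM ler_wpM2l//= rt ut !subr0.
  by rewrite (le_trans (ru _))// ler_norm.
split; first by apply/cvg_ex; exists 0.
exact: cvg_lim H.
Qed.

(** The remainder is dominated by a multiple of the squared length of [q s - q t], whose derivative
    at [t] is zero. This allows a squared distance to be differentiated along a curve without
    differentiating the projection. *)
Lemma is_derive_quadratic_approx m (q : R -> 'cV[R]_m) (f : R -> R) (t c : R)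
    g dq :
  is_derive t 1 q dq ->
  (forall s, `|f s - f t - dot g (q s - q t)| <=
     dot (q s - q t) (q s - q t) * c) ->
  is_derive t 1 f (dot g dq).
Proof.
move=> Hq Hf.
have Hd : is_derive t 1 (fun s => q s - q t) dq.
  rewrite -[dq]subr0; apply: (is_deriveB (f := q)).
have Hg : is_derive t 1 (fun s => dot g (q s - q t)) (dot g dq).
  have := is_derive_dot _ (cst g) _ t 0 _ (is_derive_cst g t 1) Hd.
  by rewrite dot0l add0r.
have Hr : is_derive t 1 (fun s => f s - f t - dot g (q s - q t)) 0.
  apply: (is_derive_dominated0 _ (fun s => dot (q s - q t) (q s - q t) * c)) => //.
  - by rewrite !subrr dotC dot0l subr0.
  - by rewrite subrr dot0l mul0r.
  have := is_derive_mul _ _ _ _ _ (is_derive_dot _ _ _ _ _ _ Hd Hd)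
    (is_derive_cst c t 1).
  by rewrite subrr dot0l dotC dot0l addr0 mul0r mulr0 addr0.
have := is_deriveD (is_deriveD Hr Hg) (is_derive_cst (f t) t 1).
rewrite add0r addr0; congr is_derive; apply/funext => s.
rewrite /cst /= !fctE; lra.
Qed.

End derivatives.

(** * Limits at infinity and decay forced by dissipation *)

Section asymptotics.
Context {R : realType}.

(** Thresholds start at 1 because the dynamics is given for positive times only and the uniform
    bounds on the trajectory are stated from time 1 on. *)
Lemma cvg0_pinftyP (V : normedModType R) (f : R -> V) :
  f t @[t --> +oo%R] --> 0 <->
  forall e, 0 < e -> exists2 T, 1 <= T & forall t, T <= t -> `|f t| <= e.
Proof.
rewrite cvgr0Pnorm_le; split => H e e0.
  have [A [_ HA]] := H e e0.
  exists (Num.max 1 (A + 1)) => [|t]; first by rewrite le_max lexx.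
  rewrite ge_max => /andP[_ At]; apply: HA.
  by rewrite (lt_le_trans _ At)// ltrDl.
have [T _ HT] := H e e0; near=> t; apply: HT.
by near: t; apply: nbhs_pinfty_ge; exact: num_real.
Unshelve. all: by end_near. Qed.

Lemma MVT_pos (f df : R -> R) (a b : R) :
  (forall t : R, 0 < t -> is_derive t 1 f (df t)) -> 0 < a -> a < b ->
  exists c, [/\ a < c, c < b & f b - f a = df c * (b - a)].
Proof.
move=> Hf a0 ab.
have [||c] := @MVT R f df a b ab.
- by move=> x; rewrite in_itv/= => /andP[ax _]; apply: Hf; apply: lt_trans ax.
- apply: derivable_within_continuous => x; rewrite in_itv/= => /andP[ax _].
  by have [] := Hf x (lt_le_trans a0 ax).
by rewrite in_itv/= => /andP[ac cb] E; exists c.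
Qed.

Lemma derive_bound_lipschitz (f df : R -> R) (L a b : R) :
  (forall t : R, 0 < t -> is_derive t 1 f (df t)) ->
  (forall t : R, 1 <= t -> `|df t| <= L) ->
  1 <= a -> 1 <= b -> `|f a - f b| <= L * `|a - b|.
Proof.
move=> Hf HL; wlog ab : a b / a <= b => [W|] a1 b1.
  case: (leP a b) => [|/ltW] ab; first exact: W.
  by rewrite distrC (distrC a); exact: W.
move: ab; rewrite le_eqVlt => /predU1P[->|ab]; first by rewrite !subrr normr0 mulr0.
have [c [ac cb E]] := MVT_pos f df a b Hf (lt_le_trans ltr01 a1) ab.
rewrite distrC E normrM (distrC a) ler_wpM2r// HL//.
by rewrite (le_trans a1)// ltW.
Qed.

(** If [K t] exceeds [e] at a late time, the bound on [dK] keeps [K] above [e / 2] on a window of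
    fixed length, over which [V] would drop below its infimum. *)
Lemma dissipation_cvg0 (V K dV dK : R -> R) (c L : R) :
  (forall t : R, 0 < t -> is_derive t 1 V (dV t)) ->
  (forall t : R, 0 < t -> is_derive t 1 K (dK t)) ->
  (forall t : R, 0 < t -> 0 <= V t) -> (forall t : R, 0 < t -> 0 <= K t) ->
  0 < c -> (forall t : R, 1 <= t -> dV t <= - (c * K t)) ->
  (forall t : R, 1 <= t -> `|dK t| <= L) ->
  K t @[t --> +oo%R] --> (0 : R).
Proof.
move=> HV HK V0 K0 c0 HVK HL; apply/cvg0_pinftyP => e e0.
have L0 : 0 <= L by rewrite (le_trans _ (HL 1 (lexx _))).
(* On a window of length [h] the function [K] changes by at most [e / 2]; the [+ 1] covers the case
   [L = 0]. *)
pose h := e / (2 * (L + 1)).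
have L1 : 0 < 2 * (L + 1) by rewrite mulr_gt0// ltr_wpDl.
have h0 : 0 < h by rewrite divr_gt0.
have Lh : L * h <= e / 2.
  have -> : e / 2 = (L + 1) * h by rewrite /h; field; lra.
  by rewrite ler_pM2r// lerDl.
have pos (t : R) : 1 <= t -> 0 < t by exact: lt_le_trans.
have Vdec s t : 1 <= s -> s <= t -> V t <= V s.
  move=> s1; rewrite le_eqVlt => /predU1P[->//|st].
  have [u [su ut E]] := MVT_pos _ _ _ _ HV (pos _ s1) st.
  have u1 : 1 <= u by rewrite (le_trans s1)// ltW.
  rewrite -subr_le0 E mulr_le0_ge0 ?subr_ge0 ?(ltW st)//.
  by rewrite (le_trans (HVK u u1))// oppr_le0 mulr_ge0 ?(ltW c0)//; exact/K0/pos.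
pose A := [set V t | t in [set t : R | 1 <= t]].
have hA : has_inf A.
  split; first by exists (V 1), 1 => /=.
  by exists 0 => _ [t /= t1 <-]; exact/V0/pos.
have d0 : 0 < c * (e / 2) * h by rewrite !mulr_gt0 ?invr_gt0.
(* From [T] on, [V] exceeds its infimum by less than the drop [c * (e / 2) * h] that one window
   would cause. *)
have [_ [T /= T1 <-] HT] := inf_adherent d0 hA.
exists T => // t Tt; rewrite leNgt; apply/negP.
have t1 : 1 <= t by exact: le_trans Tt.
rewrite ger0_norm ?K0 ?pos// => Ket.
have tth : t < t + h by rewrite ltrDl.
have [u [tu ut E]] := MVT_pos _ _ _ _ HV (pos _ t1) tth.
have u1 : 1 <= u by rewrite (le_trans t1)// ltW.
have Ku : e / 2 <= K u.
  have := derive_bound_lipschitz _ _ _ _ _ HK HL t1 u1.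
  rewrite ler_norml => /andP[_].
  have : L * `|t - u| <= L * h.
    by rewrite ler_wpM2l// distrC gtr0_norm ?subr_gt0// lerBlDl ltW.
  lra.
have : inf A <= V (t + h).
  by apply: ge_inf; [case: hA|exists (t + h) => //=; rewrite (le_trans t1)// ltW].
have := Vdec T t T1 Tt.
have : dV u * h <= - (c * (e / 2) * h).
  rewrite -mulNr ler_pM2r// (le_trans (HVK u u1))// lerN2 ler_pM2l//.
move: E; rewrite addrAC subrr add0r; lra.
Qed.

(* A variant of Barbalat's lemma. *)
Lemma vanishing_perturbed_derivative (p dp f : R -> R) (L : R) :
  (forall t : R, 0 < t -> is_derive t 1 p (dp t)) ->
  p t @[t --> +oo%R] --> (0 : R) ->
  (dp t - f t) @[t --> +oo%R] --> (0 : R) ->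
  (forall s t : R, 1 <= s -> 1 <= t -> `|f s - f t| <= L * `|s - t|) ->
  f t @[t --> +oo%R] --> (0 : R).
Proof.
move=> Hp /cvg0_pinftyP p0 /cvg0_pinftyP df0 HL; apply/cvg0_pinftyP => e e0.
have L0 : 0 <= L.
  have := HL 1 2 (lexx _) (ler1n _ 2).
  have -> : `|1 - 2| = 1 :> R by rewrite distrC addrK normr1.
  by rewrite mulr1; apply: le_trans.
(* On a window of length [h], [f] varies by at most [e / 4]. Late values of [p] below [e / 8 * h]
   give a mean slope of at most [e / 4], and slope and [f] differ by at most [e / 4]; hence [f t] is
   at most [3 * e / 4] in absolute value. *)
pose h := e / (4 * (L + 1)).
have L1 : 0 < 4 * (L + 1) by rewrite mulr_gt0// ltr_wpDl.
have h0 : 0 < h by rewrite divr_gt0.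
have Lh : L * h <= e / 4.
  have -> : e / 4 = (L + 1) * h by rewrite /h; field; lra.
  by rewrite ler_pM2r// lerDl.
have [|T1 T11 HT1] := p0 (e / 8 * h); first by rewrite mulr_gt0// divr_gt0.
have [|T2 T21 HT2] := df0 (e / 4); first by rewrite divr_gt0.
exists (Num.max T1 T2) => [|t]; first by rewrite le_max T11.
rewrite ge_max => /andP[T1t T2t].
have t1 : 1 <= t by exact: le_trans T1t.
have tth : t < t + h by rewrite ltrDl.
have [u [tu ut E]] := MVT_pos _ _ _ _ Hp (lt_le_trans ltr01 t1) tth.
have u1 : 1 <= u by rewrite (le_trans t1)// ltW.
have T1h : T1 <= t + h by rewrite (le_trans T1t)// ltW.
have {}E : dp u * h = p (t + h) - p t by rewrite E addrAC subrr add0r.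
have dpu : `|dp u| <= e / 4.
  rewrite -(ler_pM2r h0) -[X in _ * X <= _](gtr0_norm h0) -normrM E.
  rewrite (le_trans (ler_normB _ _))//.
  have := HT1 _ T1t; have := HT1 _ T1h; lra.
have ftu : `|f t - f u| <= e / 4.
  rewrite (le_trans (HL t u t1 u1))// (le_trans _ Lh)// ler_wpM2l//.
  by rewrite distrC gtr0_norm ?subr_gt0// lerBlDl ltW.
have := HT2 u (le_trans T2t (ltW tu)).
move: dpu ftu; rewrite !ler_norml; lra.
Qed.

End asymptotics.

(** * Compactness *)

Section compactness.
Context {R : realType} {m : nat}.
Implicit Types (A : set 'cV[R]_m) (x y : 'cV[R]_m).

(** The norm of the matrix space is the maximum norm; this comparison and the next carry continuity
    and limits from one norm to the other. *)
Lemma enorm_le_norm x : enorm x <= m%:R * `|x|.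
Proof.
apply: le_trans (enorm_le_sum x) _.
rewrite -[m in m%:R]card_ord -sumr_const mulr_suml; apply: ler_sum => i _.
rewrite mul1r [leRHS]/Num.Def.normr/= mx_normrE.
exact: (le_bigmax _ (fun ij => `|x ij.1 ij.2|) (i, 0)).
Qed.

Lemma norm_le_enorm x : `|x| <= enorm x.
Proof.
rewrite [leLHS]/Num.Def.normr/= mx_normrE (bigmax_le _ (enorm_ge0 x))//=.
by move=> [i j] _ /=; rewrite ord1 coord_le_enorm.
Qed.

Lemma enorm_lipschitz_continuous (f : 'cV[R]_m -> R) (c : R) :
  (forall x y, `|f x - f y| <= c * enorm (x - y)) -> continuous f.
Proof.
move=> fc x; apply/(@cvgrPdist_le _ _ _ (nbhs x) (nbhs_filter x)) => e e0.
pose k := `|c| * m%:R + 1.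
have k0 : 0 < k by rewrite ltr_wpDl// mulr_ge0.
near=> y.
rewrite (le_trans (fc x y))// (@le_trans _ _ (k * `|x - y|))//.
  rewrite mulrDl mul1r ler_wpDr// -mulrA.
  rewrite (le_trans (ler_wpM2r (enorm_ge0 _) (ler_norm c)))//.
  by rewrite ler_wpM2l// enorm_le_norm.
rewrite mulrC -ler_pdivlMr//; near: y.
apply/nbhs_ballP; exists (e / k) => [|z /=]; first by rewrite /= divr_gt0.
by rewrite mx_norm_ball => /ltW.
Unshelve. all: by end_near. Qed.

Lemma enorm_lipschitz x y : `|enorm x - enorm y| <= enorm (x - y).
Proof.
have H u v : enorm u - enorm v <= enorm (u - v).
  by rewrite lerBlDr -{1}(subrK v u) enormD.
by rewrite ler_norml H andbT lerNl opprB enormBC H.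
Qed.

Lemma enorm_continuous : continuous (@enorm R m).
Proof.
by apply: (enorm_lipschitz_continuous _ 1) => x y; rewrite mul1r enorm_lipschitz.
Qed.

Lemma trmx_continuous : continuous (fun v : 'rV[R]_m => v^T : 'cV[R]_m).
Proof.
move=> v s /= /nbhs_ballP[e e0 es]; apply/nbhs_ballP; exists e => //= w [_ vw].
by apply: es; split => // i j; rewrite !mxE; exact: vw.
Qed.

(** Heine-Borel for column vectors, transported from row vectors by the continuity of
    transposition. *)
Lemma enorm_bounded_closed_compact A (b : R) :
  closed A -> (forall x, A x -> enorm x <= b) -> compact A.
Proof.
move=> Acl Ab.
have -> : A = (fun v : 'rV[R]_m => v^T) @` [set v : 'rV[R]_m | A v^T].
  apply/seteqP; split => [x Ax|_ [v Av <-]//].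
  by exists x^T => //=; rewrite trmxK.
apply: continuous_compact; first exact/continuous_subspaceT/trmx_continuous.
apply: bounded_closed_compact; last first.
  by apply: preimage_closed Acl => v _; exact: trmx_continuous.
exists b; split => [|c bc v /= /Ab vb]; first exact: num_real.
apply: le_trans (ltW bc); apply: le_trans vb.
rewrite [leLHS]/Num.Def.normr/= mx_normrE (bigmax_le _ (enorm_ge0 _))//=.
by move=> [i j] _ /=; have := coord_le_enorm v^T j; rewrite mxE ord1.
Qed.

Lemma compact_pos_lbound (T : topologicalType) (K : set T) (f : T -> R) :
  compact K -> continuous f -> (forall z, K z -> 0 < f z) ->
  exists2 d, 0 < d & forall z, K z -> d <= f z.
Proof.
move=> Kc fc f0.
have [->|/set0P K0] := eqVneq K set0; first by exists 1.
have [c /set_mem Kcc H] := compact_EVT_min K0 Kc (continuous_subspaceT fc).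
by exists (f c) => [|x Kx]; [exact: f0|apply/H/mem_set].
Qed.

Lemma continuous_fsum (T : topologicalType) n (f : 'I_n -> T -> R) :
  (forall i, continuous (f i)) -> continuous (fun z => \sum_(i < n) f i z).
Proof.
move=> fc; rewrite (_ : (fun _ => _) = \sum_(i < n) f i).
  elim/big_ind: _ => [|g h gc hc|//]; first exact: cst_continuous.
  by move=> x; apply: cvgD; [exact: gc|exact: hc].
by apply/funext => x; rewrite fct_sumE.
Qed.

(** The quadratic form is continuous and positive on the compact product of a ball of positions and
    the unit sphere of vectors, so it has a positive lower bound there; homogeneity extends it to
    all vectors. *)
Lemma posdef_uniform_on_ball (M : 'cV[R]_m -> 'M[R]_m) (b : R) :
  continuous M -> (forall q x, x != 0 -> 0 < dot x (M q *m x)) ->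
  exists2 c, 0 < c &
    forall q x, enorm q <= b -> c * dot x x <= dot x (M q *m x).
Proof.
move=> Mc Mpos.
pose f (z : 'cV[R]_m * 'cV[R]_m) := dot z.2 (M z.1 *m z.2).
pose B := [set q : 'cV[R]_m | enorm q <= b].
pose S := [set x : 'cV[R]_m | enorm x = 1].
have Bc : compact B.
  apply: (enorm_bounded_closed_compact _ b) => //.
  apply: (preimage_closed (f := @enorm R m)) (@closed_le R b) => x _.
  exact: enorm_continuous.
have Sc : compact S.
  apply: (enorm_bounded_closed_compact _ 1) => [|x /= ->//].
  apply: (preimage_closed (f := @enorm R m)) (@closed_eq R 1) => x _.
  exact: enorm_continuous.
have crd i : continuous (fun z : 'cV[R]_m * 'cV[R]_m => z.2 i 0).
  move=> z; apply: (@continuous_comp _ _ _ snd (fun x : 'cV[R]_m => x i 0)).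
    exact: cvg_snd.
  exact: coord_continuous.
have fcont : continuous f.
  have -> : f = fun z => \sum_(i < m) (z.2 i 0 *
      \sum_(j < m) (M z.1 i j * z.2 j 0)).
    by apply/funext => z; apply: eq_bigr => i _; rewrite mxE.
  apply: continuous_fsum => i z; apply: cvgM; first exact: crd.
  apply: (continuous_fsum _ _ (fun j (z : 'cV[R]_m * 'cV[R]_m) =>
    M z.1 i j * z.2 j 0)) => j {}z; apply: cvgM; last exact: crd.
  apply: (@continuous_comp _ _ _ fst (fun x : 'cV[R]_m => M x i j)).
    exact: cvg_fst.
  apply: (@continuous_comp _ _ _ M (fun A : 'M[R]_m => A i j)); first exact: Mc.
  exact: coord_continuous.
have [|c c0 H] := compact_pos_lbound _ _ f (compact_setX Bc Sc) fcont.
  move=> [q x] [_]; rewrite /S/f/= => x1; apply: Mpos; apply/eqP => x0.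
  by move: x1; rewrite x0 enorm0 => /eqP; rewrite eq_sym oner_eq0.
exists c => // q x qb.
have [->|x0] := eqVneq x 0; first by rewrite !dot0l mulr0.
have ex0 : 0 < enorm x.
  by rewrite lt_def enorm_ge0 andbT; apply: contra x0 => /eqP/enorm0_eq0 ->.
have := H (q, (enorm x)^-1 *: x); rewrite /f/= -scalemxAr dotZl dotZr => /(_ _).
rewrite mulrA -expr2 exprVn enorm_sq ler_pdivlMl.
  rewrite mulrC; apply; split => //=.
  by rewrite /S/= enormZ ger0_norm ?invr_ge0 ?enorm_ge0// mulVf// gt_eqF.
by rewrite -enorm_sq exprn_gt0.
Qed.

End compactness.

(** * Distances to the individual sets and to their intersection *)

Section intersection.
Context {R : realType} {n m : nat}.
Context (X : 'I_n -> set 'cV[R]_m) (P : 'I_n -> 'cV[R]_m -> 'cV[R]_m).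
Hypotheses (Xconv : forall i, is_convex_set (X i)).
Hypotheses (XP : forall i, is_projection (X i) (P i)).

(** Each summand is the distance to [X j], so this vanishes exactly on [common_set X] and can stand
    in for the distance to it in compactness arguments. *)
Definition total_dist (x : 'cV[R]_m) : R := \sum_(j < n) enorm (x - P j x).

Lemma total_dist_continuous : continuous total_dist.
Proof.
apply: continuous_fsum => j; apply: (enorm_lipschitz_continuous _ 1) => x y.
rewrite mul1r (le_trans (enorm_lipschitz _ _))//.
exact: projection_residual_lipschitz (Xconv j) (XP j) x y.
Qed.

Lemma total_dist_ge0 x : 0 <= total_dist x.
Proof. by apply: sumr_ge0 => j _; exact: enorm_ge0. Qed.

Lemma total_dist_gt0 x : ~ common_set X x -> 0 < total_dist x.
Proof.
move=> xX; rewrite lt_def total_dist_ge0 andbT; apply/negP => /eqP G0; apply: xX.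
move=> j _; have /eqP : enorm (x - P j x) = 0.
  by apply: (psumr_eq0P _ G0) => // i _; exact: enorm_ge0.
move=> /eqP/enorm0_eq0/eqP; rewrite subr_eq0 => /eqP ->.
by have [] := XP j x.
Qed.

(** By convexity [s *: P j x + (1 - s) *: x0] lies in [X j], and its distance to the moved point is
    [s] times that from [x] to [P j x]. *)
Lemma total_dist_star x0 x (s : R) : common_set X x0 -> 0 <= s -> s <= 1 ->
  total_dist (x0 + s *: (x - x0)) <= s * total_dist x.
Proof.
move=> Xx0 s0 s1; rewrite mulr_sumr; apply: ler_sum => j _.
have := projection_le _ _ (XP j) (x0 + s *: (x - x0)) _
  (Xconv j _ _ s (projection_in _ _ (XP j) x) (Xx0 j I) s0 s1).
move=> /le_trans; apply.
have -> : x0 + s *: (x - x0) - (s *: P j x + (1 - s) *: x0) = s *: (x - P j x).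
  by apply/matrixP => i k; rewrite !mxE; ring.
by rewrite enormZ ger0_norm.
Qed.

(* [total_dist] is positive on a sphere about a point of the bounded
   intersection, hence grows at least linearly along rays from that point. *)
Lemma total_dist_coercive (c : R) :
  common_set X !=set0 -> ebounded_set (common_set X) ->
  exists b, forall x, total_dist x <= c -> enorm x <= b.
Proof.
move=> [x0 Xx0] [r Hr].
have r0 : enorm x0 <= r by exact: Hr.
have rr : 0 <= r by rewrite (le_trans _ r0)// enorm_ge0.
(* Two points of the intersection are at most [2 * r] apart, so the sphere of radius [p] about [x0]
   misses it. *)
pose p := 2 * r + 1.
have p0 : 0 < p by rewrite ltr_wpDl// mulr_ge0.
pose S := [set y : 'cV[R]_m | enorm (y - x0) = p].
have Scont : continuous (fun y : 'cV[R]_m => enorm (y - x0)).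
  apply: (enorm_lipschitz_continuous _ 1) => x y.
  rewrite mul1r (le_trans (enorm_lipschitz _ _))// le_eqVlt; apply/orP; left.
  by apply/eqP; congr enorm; apply/matrixP => i j; rewrite !mxE; ring.
have Sc : compact S.
  apply: (enorm_bounded_closed_compact _ (p + r)) => [|y /= yp].
    apply: (preimage_closed (f := fun y : 'cV[R]_m => enorm (y - x0)))
      (@closed_eq R p) => x _.
    exact: Scont.
  by rewrite -(subrK x0 y) (le_trans (enormD _ _))// lerD// yp.
have [|d d0 Hd] := compact_pos_lbound _ _ _ Sc total_dist_continuous.
  move=> y yp; apply: total_dist_gt0 => /Hr yr.
  have := enormB y x0; rewrite yp /p; lra.
exists (r + Num.max p (p * c / d)) => x Gx.
rewrite -(subrK x0 x) (le_trans (enormD _ _))// addrC lerD// le_max.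
have [//|px] := leP (enorm (x - x0)) p; apply/orP; right.
have e0 : 0 < enorm (x - x0) by exact: lt_trans px.
(* This factor brings [x] back to the sphere along the ray from [x0]. Then [d <= s * c], which
   rearranges to the bound [p * c / d] on the distance to [x0]. *)
pose s := p / enorm (x - x0).
have s0 : 0 <= s by rewrite divr_ge0// ltW.
have s1 : s <= 1 by rewrite ler_pdivrMr// mul1r ltW.
have : d <= s * c.
  apply: (@le_trans _ _ (total_dist (x0 + s *: (x - x0)))).
    apply: Hd; rewrite /S/= addrAC subrr add0r enormZ ger0_norm//.
    by rewrite /s divfK// gt_eqF.
  by rewrite (le_trans (total_dist_star _ _ _ Xx0 s0 s1))// ler_wpM2l.
by rewrite /s mulrAC !ler_pdivlMr// mulrC.
Qed.

(** On the compact set of points of norm at most [b] at distance at least [e] from the intersection,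
    [total_dist] is positive, hence bounded below by some [d > 0]. *)
Lemma dist_common_set_small (b e : R) : common_set X !=set0 -> 0 < e ->
  exists2 d, 0 < d & forall x, enorm x <= b -> total_dist x < d ->
    dist_to_set (common_set X) x <= e.
Proof.
move=> X0 e0.
pose D := dist_to_set (common_set X).
have Dc : continuous D.
  apply: (enorm_lipschitz_continuous _ 1) => x y.
  by rewrite mul1r dist_to_set_lipschitz.
pose K := [set x : 'cV[R]_m | enorm x <= b] `&` [set x | e <= D x].
have Kc : compact K.
  apply: (enorm_bounded_closed_compact _ b) => [|x []//].
  apply: closedI.
    apply: (preimage_closed (f := @enorm R m)) (@closed_le R b) => x _.
    exact: enorm_continuous.
  by apply: (preimage_closed (f := D)) (@closed_ge R e) => x _; exact: Dc.
have [|d d0 Hd] := compact_pos_lbound _ _ _ Kc total_dist_continuous.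
  move=> x [_ /= eD]; apply: total_dist_gt0 => Xx.
  have := dist_to_set_le _ x x Xx; rewrite -/D subrr enorm0; lra.
exists d => // x xb; rewrite ltNge => /negP dx; rewrite leNgt; apply/negP => De.
by apply: dx; apply: Hd; split => //=; exact: ltW.
Qed.

End intersection.

(** The triangle inequality is summed along a path without repeated nodes, which has fewer than [n]
    edges. It serves both to bound all disagreements and to make them vanish. *)
Lemma connected_pseudodist_le {R : realType} {n : nat} (e : rel 'I_n)
    (D : 'I_n -> 'I_n -> R) (c : R) :
  graph_connected e -> 0 <= c -> (forall i, D i i = 0) ->
  (forall i j l, D i l <= D i j + D j l) -> (forall i j, e i j -> D i j <= c) ->
  forall i j, D i j <= n%:R * c.
Proof.
move=> econn c0 D0 Dtri De i j.
have /connectP[p ep ->] := econn i j.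
case/shortenP: ep => {}p ep up _.
apply: (@le_trans _ _ ((size p)%:R * c)).
  elim: p i ep {up} => [|k p IH] i /=; first by rewrite D0 mul0r.
  move=> /andP[eik /IH pk]; rewrite (le_trans (Dtri _ k _))//.
  by rewrite -natr1 mulrDl mul1r addrC lerD// De.
rewrite ler_wpM2r// ler_nat -[leqRHS]card_ord.
by apply: leq_trans (max_card (mem (i :: p))); rewrite (card_uniqP up)/= leqnSn.
Qed.

(** * Vanishing functions, finite families and summation by parts on a graph *)

Section vanishing.
Context {R : realType}.
Implicit Types (f g : R -> R).

Lemma cvg0_le (V : normedModType R) (f : R -> V) g :
  (forall t : R, 1 <= t -> `|f t| <= g t) ->
  g t @[t --> +oo%R] --> (0 : R) -> f t @[t --> +oo%R] --> (0 : V).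
Proof.
move=> fg /cvg0_pinftyP g0; apply/cvg0_pinftyP => e /g0[T T1 HT].
exists T => // t Tt; rewrite (le_trans (fg t (le_trans T1 Tt)))//.
by rewrite (le_trans (ler_norm _))// HT.
Qed.

Lemma cvg0_sqr_le f g : (forall t : R, 1 <= t -> f t ^+ 2 <= g t) ->
  g t @[t --> +oo%R] --> (0 : R) -> f t @[t --> +oo%R] --> (0 : R).
Proof.
move=> fg /cvg0_pinftyP g0; apply/cvg0_pinftyP => e e0.
have [|T T1 HT] := g0 (e ^+ 2); first by rewrite exprn_gt0.
exists T => // t Tt; rewrite -ler_sqr ?nnegrE ?(ltW e0)//.
rewrite real_normK ?num_real// (le_trans (fg t (le_trans T1 Tt)))//.
by rewrite (le_trans (ler_norm _))// HT.
Qed.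

Lemma cvg0_sum n (f : 'I_n -> R -> R) :
  (forall i, f i t @[t --> +oo%R] --> (0 : R)) ->
  (\sum_(i < n) f i t) @[t --> +oo%R] --> (0 : R).
Proof.
move=> f0; rewrite (_ : (fun _ => _) = \sum_(i < n) f i).
  elim/big_ind: _ => [|g h g0 h0|//]; first exact: cvg_cst.
  by rewrite -[X in _ --> X](addr0 0); exact: cvgD.
by apply/funext => t; rewrite fct_sumE.
Qed.

Lemma cvg0_mulr f (c : R) :
  f t @[t --> +oo%R] --> (0 : R) -> (f t * c) @[t --> +oo%R] --> (0 : R).
Proof.
move=> f0; rewrite -[X in _ --> X](mul0r c).
by apply: cvgM => //; exact: cvg_cst.
Qed.

Lemma cvg0_add f g :
  f t @[t --> +oo%R] --> (0 : R) -> g t @[t --> +oo%R] --> (0 : R) ->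
  (f t + g t) @[t --> +oo%R] --> (0 : R).
Proof. by move=> f0 g0; rewrite -[X in _ --> X](addr0 0); exact: cvgD. Qed.

Lemma cvg0_coord m (f : R -> 'cV[R]_m) :
  (forall r, f t r 0 @[t --> +oo%R] --> (0 : R)) ->
  enorm (f t) @[t --> +oo%R] --> (0 : R).
Proof.
move=> f0; apply: (cvg0_le _ _ (fun t => \sum_(r < m) `|f t r 0|)) => [t _|].
  by rewrite ger0_norm ?enorm_ge0// enorm_le_sum.
by apply: cvg0_sum => r; apply/norm_cvg0P.
Qed.

(** Turns energy bounds into norm bounds without square roots, where the size of the constant is
    irrelevant. *)
Lemma le_add1_of_sqr_le (x y : R) : x ^+ 2 <= y -> x <= y + 1.
Proof.
by have := sqr_ge0 (x - 1); have := sqr_ge0 x; rewrite sqrrB1 mulr2n; lra.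
Qed.

Lemma ord_uniform_bound n (Q : 'I_n -> R -> Prop) :
  (forall i b c, b <= c -> Q i b -> Q i c) -> (forall i, exists b, Q i b) ->
  exists2 b, 0 <= b & forall i, Q i b.
Proof.
move=> Qmono /choice[f Qf]; exists (\sum_i `|f i|); first exact: sumr_ge0.
move=> i; apply: Qmono (Qf i); rewrite (bigD1 i)//=.
by rewrite (le_trans (ler_norm _))// lerDl sumr_ge0.
Qed.

(** Exchanging [i] and [j] flips the sign of [x i - x j] and keeps the weight, so averaging the
    double sum with its exchanged form replaces [y i] by half of [y i - y j]. *)
Lemma laplacian_dot n m (w : 'I_n -> 'I_n -> R) (x y : 'I_n -> 'cV[R]_m) :
  (forall i j, w i j = w j i) ->
  \sum_i dot (\sum_j w i j *: (x i - x j)) (y i) =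
  (\sum_i \sum_j w i j * dot (x i - x j) (y i - y j)) / 2.
Proof.
move=> wsym.
pose S := \sum_i \sum_j w i j * dot (x i - x j) (y i).
have E1 : \sum_i dot (\sum_j w i j *: (x i - x j)) (y i) = S.
  apply: eq_bigr => i _; rewrite dot_suml.
  by apply: eq_bigr => j _; rewrite dotZl.
have E2 : S = - \sum_i \sum_j w i j * dot (x i - x j) (y j).
  rewrite /S exchange_big -sumrN; apply: eq_bigr => i _.
  rewrite -sumrN; apply: eq_bigr => j _.
  by rewrite wsym -mulrN -dotNl opprB.
have -> : \sum_i \sum_j w i j * dot (x i - x j) (y i - y j) = S + S.
  rewrite {2}E2 -sumrB; apply: eq_bigr => i _; rewrite -sumrB.
  by apply: eq_bigr => j _; rewrite dotBr mulrBr.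
by rewrite E1; field.
Qed.

End vanishing.

(** The point [P j (x j)] lies in [X j], so its distance to [x i] bounds the distance from [x i] to
    [X j]. *)
Lemma total_dist_le_disagreement {R : realType} {n m : nat}
    (X : 'I_n -> set 'cV[R]_m) (P : 'I_n -> 'cV[R]_m -> 'cV[R]_m)
    (x : 'I_n -> 'cV[R]_m) i :
  (forall i, is_projection (X i) (P i)) ->
  total_dist P (x i) <=
  \sum_j (enorm (x i - x j) + enorm (x j - P j (x j))).
Proof.
move=> XP; apply: ler_sum => j _.
have PX := projection_in _ _ (XP j) (x j).
by rewrite (le_trans (projection_le _ _ (XP j) _ _ PX))// enorm_dist.
Qed.

(** * The closed loop *)

Section closed_loop.
Context {R : realType} {n m : nat}.
Context (M : 'I_n -> 'cV[R]_m -> 'M[R]_m).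
Context (C : 'I_n -> 'cV[R]_m -> 'cV[R]_m -> 'M[R]_m).
Context (X : 'I_n -> set 'cV[R]_m) (P : 'I_n -> 'cV[R]_m -> 'cV[R]_m).
Context (e : rel 'I_n) (w : 'I_n -> 'I_n -> R) (k : R).
Hypotheses (Msym : forall i q, (M i q)^T = M i q)
  (Mpos : forall i q (x : 'cV[R]_m), x != 0 -> 0 < dot x (M i q *m x))
  (Mbnd : forall i, exists b : R, forall q x,
     enorm (M i q *m x) <= b * enorm x)
  (Mdiff : forall i q, differentiable (M i) q)
  (skew : forall i q qd,
     ('D_qd (M i) q - 2%:R *: C i q qd)^T = - ('D_qd (M i) q - 2%:R *: C i q qd))
  (Cbnd : forall i, exists kC : R, 0 < kC /\
     forall q qd x, enorm (C i q qd *m x) <= kC * enorm qd * enorm x)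
  (Xconv : forall i, is_convex_set (X i))
  (X0ne : common_set X !=set0) (X0bnd : ebounded_set (common_set X))
  (XP : forall i, is_projection (X i) (P i))
  (wsym : forall i j, w i j = w j i) (w0 : forall i j, 0 <= w i j)
  (we : forall i j, e i j -> 0 < w i j)
  (k0 : 0 < k) (econn : graph_connected e).
Context (q dq ddq : 'I_n -> R -> 'cV[R]_m).

(** The static part of the control. The sum over all [j] is meant for weights extended by zero off
    the edges. *)
Definition force i t : 'cV[R]_m :=
  - (q i t - P i (q i t)) - \sum_j w i j *: (q i t - q j t).

Hypotheses (Hdq : forall i (t : R), 0 < t -> is_derive t 1 (q i) (dq i t))
  (Hddq : forall i (t : R), 0 < t -> is_derive t 1 (dq i) (ddq i t))
  (Hdyn : forall i (t : R), 0 < t ->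
     M i (q i t) *m ddq i t + C i (q i t) (dq i t) *m dq i t =
     - (k *: dq i t) + force i t).

Definition momentum i t := M i (q i t) *m dq i t.
Definition kinetic i t := dot (dq i t) (momentum i t) / 2.
Definition constraint_energy i t :=
  dot (q i t - P i (q i t)) (q i t - P i (q i t)) / 2.
(** The divisor is 4 because the double sum in [energy] counts each unordered pair twice. *)
Definition coupling_energy i j t :=
  w i j * dot (q i t - q j t) (q i t - q j t) / 4.
Definition energy t :=
  \sum_i (kinetic i t + constraint_energy i t + \sum_j coupling_energy i j t).

(* Skew-symmetry of [Mdot - 2 C] and symmetry of [Mdot] determine [Mdot]. *)
Lemma inertia_derivativeE i x v : 'D_v (M i) x = C i x v + (C i x v)^T.
Proof.
have Ms : ('D_v (M i) x)^T = 'D_v (M i) x.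
  have dM : derivable (M i) x v by exact: diff_derivable.
  have Mrs r s : (fun y => M i y s r) = (fun y => M i y r s).
    by apply/funext => y; rewrite -[in LHS]Msym mxE.
  by rewrite derive_mx//; apply/matrixP => r s; rewrite !mxE Mrs.
have := skew i x v; rewrite linearB/= linearZ/= Ms => E.
have {}E : 2%:R *: 'D_v (M i) x = 2%:R *: (C i x v + (C i x v)^T).
  rewrite scalerDr; apply/matrixP => r s.
  by have /matrixP/(_ r s) := E; rewrite !mxE; lra.
by apply: scalerI E; rewrite pnatr_eq0.
Qed.

(** Inserting [C + C^T] for the derivative of the inertia cancels [C] against the dynamics. The
    acceleration disappears, so bounds on positions and velocities control the result. *)
Lemma is_derive_momentum i (t : R) : 0 < t ->
  is_derive t 1 (momentum i)
    ((C i (q i t) (dq i t))^T *m dq i t - k *: dq i t + force i t).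
Proof.
move=> t0.
have dM := is_derive_comp_diff _ _ _ _ _ _ _ (Mdiff i (q i t)) (Hdq i t t0).
apply: is_derive_eq (is_derive_mulmx _ _ _ _ _ _ _ _ dM (Hddq i t t0)) _.
rewrite inertia_derivativeE mulmxDl -[RHS]addrA -Hdyn//.
by rewrite -[LHS]addrA [LHS]addrC [RHS]addrA.
Qed.

(** The Coriolis terms enter through [C^T] from the momentum and [- C] from the acceleration, and
    their products with [dq] on both sides cancel. *)
Lemma is_derive_kinetic i (t : R) : 0 < t ->
  is_derive t 1 (kinetic i) (dot (dq i t) (- (k *: dq i t) + force i t)).
Proof.
move=> t0.
have := is_derive_dot _ _ _ _ _ _ (Hddq i t t0) (is_derive_momentum i t t0).
move=> /is_derive_mul/(_ (is_derive_cst (2^-1 : R) t 1)).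
congr is_derive; rewrite mulr0 addr0.
have -> : dot (ddq i t) (momentum i t) = dot (dq i t) (M i (q i t) *m ddq i t).
  by rewrite /momentum -{1}Msym dot_trmx dotC.
have -> : M i (q i t) *m ddq i t =
    - (k *: dq i t) + force i t - C i (q i t) (dq i t) *m dq i t.
  by rewrite -Hdyn// addrK.
rewrite !(dotDr, dotBr, dotNr) dot_trmx (dotC (C i (q i t) (dq i t) *m dq i t)).
by rewrite /cst; field.
Qed.

Lemma is_derive_constraint_energy i (t : R) : 0 < t ->
  is_derive t 1 (constraint_energy i) (dot (q i t - P i (q i t)) (dq i t)).
Proof.
move=> t0; apply: (is_derive_quadratic_approx _ (q i) _ _ 2^-1) => [|s].
  exact: Hdq.
exact: projection_sqdist_expansion (Xconv i) (XP i) (q i t) (q i s).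
Qed.

Lemma is_derive_coupling_energy i j (t : R) : 0 < t ->
  is_derive t 1 (coupling_energy i j)
    (w i j * dot (q i t - q j t) (dq i t - dq j t) / 2).
Proof.
move=> t0.
have Hd : is_derive t 1 (fun s => q i s - q j s) (dq i t - dq j t).
  exact: (is_deriveB (Hdq i t t0) (Hdq j t t0)).
have := is_derive_dot _ _ _ _ _ _ Hd Hd.
move=> /is_derive_mul/(_ (is_derive_cst (w i j / 4 : R) t 1)).
have -> : (fun s => dot (q i s - q j s) (q i s - q j s) * cst (w i j / 4) s) =
    coupling_energy i j.
  by apply/funext => s; rewrite /coupling_energy /cst; ring.
congr is_derive; rewrite (dotC (dq i t - dq j t)) /cst.
by field.
Qed.

(** The power of the static forces cancels the derivatives of the potentials, the coupling part by
    [laplacian_dot]; only the damping remains. *)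
Lemma is_derive_energy (t : R) : 0 < t ->
  is_derive t 1 energy (- (k * \sum_i dot (dq i t) (dq i t))).
Proof.
move=> t0.
have : is_derive t 1 energy (\sum_i (dot (dq i t) (- (k *: dq i t) + force i t)
    + dot (q i t - P i (q i t)) (dq i t)
    + \sum_j w i j * dot (q i t - q j t) (dq i t - dq j t) / 2)).
  apply: is_derive_fsum => i.
  apply: (is_deriveD (f := fun s => kinetic i s + constraint_energy i s)).
    exact: (is_deriveD (is_derive_kinetic i t t0)
      (is_derive_constraint_energy i t t0)).
  by apply: is_derive_fsum => j; exact: is_derive_coupling_energy.
congr is_derive; rewrite big_split/=.
have -> : \sum_i \sum_j w i j * dot (q i t - q j t) (dq i t - dq j t) / 2 =
    \sum_i dot (\sum_j w i j *: (q i t - q j t)) (dq i t).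
  rewrite (laplacian_dot _ _ _ _ (dq^~ t))// mulr_suml.
  by apply: eq_bigr => i _; rewrite mulr_suml.
rewrite -big_split/= mulr_sumr -sumrN; apply: eq_bigr => i _.
rewrite /force !(dotDr, dotBr, dotNr, dotZr) dotBl !(dotC _ (dq i t)).
ring.
Qed.

(** * Uniform bounds along the trajectory *)

Lemma kinetic_ge0 i (t : R) : 0 <= kinetic i t.
Proof.
rewrite /kinetic divr_ge0//; have [->|x0] := eqVneq (dq i t) 0.
  by rewrite dot0l.
exact/ltW/Mpos.
Qed.

Lemma constraint_energy_ge0 i (t : R) : 0 <= constraint_energy i t.
Proof. by rewrite divr_ge0// dot_ge0. Qed.

Lemma coupling_energy_ge0 i j (t : R) : 0 <= coupling_energy i j t.
Proof. by rewrite divr_ge0// mulr_ge0// dot_ge0. Qed.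

Lemma energy_term_ge0 i (t : R) :
  0 <= kinetic i t + constraint_energy i t + \sum_j coupling_energy i j t.
Proof.
rewrite !addr_ge0 ?kinetic_ge0 ?constraint_energy_ge0//.
by apply: sumr_ge0 => j _; exact: coupling_energy_ge0.
Qed.

(** Time 1 serves as initial time, since nothing is assumed at time 0. *)
Lemma energy_le (t : R) : 1 <= t -> energy t <= energy 1.
Proof.
rewrite le_eqVlt => /predU1P[->//|t1].
have [c [c1 _ E]] := MVT_pos _ _ _ _ is_derive_energy ltr01 t1.
rewrite -subr_le0 E mulr_le0_ge0 ?subr_ge0 ?(ltW t1)// oppr_le0 mulr_ge0//.
  exact: ltW.
by apply: sumr_ge0 => i _; exact: dot_ge0.
Qed.

Lemma energy_term_le i (t : R) : 1 <= t ->
  kinetic i t + constraint_energy i t + \sum_j coupling_energy i j t <= energy 1.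
Proof.
move=> t1; apply: le_trans (energy_le t t1).
rewrite [leRHS](bigD1 i)//= lerDl.
by apply: sumr_ge0 => j _; exact: energy_term_ge0.
Qed.

Lemma kinetic_le i (t : R) : 1 <= t -> kinetic i t <= energy 1.
Proof.
move=> t1; apply: le_trans (energy_term_le i t t1).
rewrite -addrA lerDl addr_ge0 ?constraint_energy_ge0//.
by apply: sumr_ge0 => j _; exact: coupling_energy_ge0.
Qed.

Lemma constraint_energy_le i (t : R) : 1 <= t -> constraint_energy i t <= energy 1.
Proof.
move=> t1; apply: le_trans (energy_term_le i t t1).
rewrite addrAC addrC lerDl addr_ge0 ?kinetic_ge0//.
by apply: sumr_ge0 => j _; exact: coupling_energy_ge0.
Qed.

Lemma coupling_energy_le i j (t : R) : 1 <= t -> coupling_energy i j t <= energy 1.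
Proof.
move=> t1; apply: le_trans (energy_term_le i t t1).
rewrite (bigD1 j)//= addrCA lerDl !addr_ge0 ?kinetic_ge0 ?constraint_energy_ge0//.
by apply: sumr_ge0 => l _; exact: coupling_energy_ge0.
Qed.

Lemma trajectory_bounded :
  exists2 b, 0 <= b & forall i (t : R), 1 <= t -> enorm (q i t) <= b.
Proof.
have [d d0 Hd] : exists2 d : R, 0 <= d & forall i, forall j (t : R), 1 <= t ->
    e i j -> enorm (q i t - q j t) <= d.
  apply: ord_uniform_bound => [i b c bc H j t t1 eij|i].
    exact: le_trans (H j t t1 eij) bc.
  have [d d0 Hd] : exists2 d : R, 0 <= d & forall j (t : R), 1 <= t ->
      e i j -> enorm (q i t - q j t) <= d.
    apply: ord_uniform_bound => [j b c bc H t t1 eij|j].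
      exact: le_trans (H t t1 eij) bc.
    exists (energy 1 * 4 / w i j + 1) => t t1 eij.
    apply: le_add1_of_sqr_le; rewrite enorm_sq ler_pdivlMr ?we//.
    have := coupling_energy_le i j t t1.
    by rewrite /coupling_energy ler_pdivrMr// mulrC.
  by exists d.
(* Each of the [n] summands of [total_dist] is at most [n%:R * d], the disagreement accumulated
   along a path, plus [energy 1 * 2 + 1], the residual of the other agent. *)
have [b Hb] := total_dist_coercive X P Xconv XP
  (n%:R * (n%:R * d + (energy 1 * 2 + 1))) X0ne X0bnd.
exists (Num.max 0 b) => [|i t t1]; first by rewrite le_max lexx.
rewrite le_max; apply/orP; right; apply: Hb.
apply: le_trans (total_dist_le_disagreement X P (q^~ t) i XP) _.
rewrite -[X in X%:R * _]card_ord -sumr_const mulr_suml; apply: ler_sum => j _.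
rewrite mul1r lerD//.
  apply: (connected_pseudodist_le e (fun i j => enorm (q i t - q j t)) d) => //.
  - by move=> l; rewrite subrr enorm0.
  - by move=> ? ? ?; exact: enorm_dist.
  - by move=> ? ?; exact: Hd.
apply: le_add1_of_sqr_le; rewrite enorm_sq -ler_pdivrMr//.
exact: constraint_energy_le.
Qed.

Lemma dq_sqr_le_kinetic i : exists2 c, 0 < c &
  forall t : R, 1 <= t -> enorm (dq i t) ^+ 2 <= kinetic i t * c.
Proof.
have [b _ Hb] := trajectory_bounded.
have Mc : continuous (M i) by move=> x; exact: differentiable_continuous.
have [c c0 Hc] := posdef_uniform_on_ball (M i) b Mc (Mpos i).
exists (2 / c) => [|t t1]; first by rewrite divr_gt0.
rewrite mulrA ler_pdivlMr// mulrC enorm_sq /kinetic divfK//.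
exact/Hc/Hb.
Qed.

Lemma velocity_bounded :
  exists2 b, 0 <= b & forall i (t : R), 1 <= t -> enorm (dq i t) <= b.
Proof.
apply: ord_uniform_bound => [i b c bc H t /H|i]; first by move/le_trans; apply.
have [c c0 Hc] := dq_sqr_le_kinetic i.
exists (energy 1 * c + 1) => t t1; apply: le_add1_of_sqr_le.
by rewrite (le_trans (Hc t t1))// ler_pM2r// kinetic_le.
Qed.

Lemma force_bounded :
  exists2 b, 0 <= b & forall i (t : R), 1 <= t -> enorm (force i t) <= b.
Proof.
have [b b0 Hb] := trajectory_bounded.
case: X0ne => x0 Xx0.
apply: ord_uniform_bound => [i c d cd H t /H|i]; first by move/le_trans; apply.
exists ((b + enorm x0) + \sum_j w i j * (b + b)) => t t1.
rewrite (le_trans (enormB _ _))// enormN lerD//.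
  (* The common point [x0] competes with the projection, so the residual is no longer than
     [q i t - x0]. *)
  rewrite (le_trans (projection_le _ _ (XP i) _ _ (Xx0 i I)))//.
  by rewrite (le_trans (enormB _ _))// lerD2r Hb.
rewrite (le_trans (enorm_sum _ _))//; apply: ler_sum => j _.
rewrite enormZ ger0_norm// ler_wpM2l// (le_trans (enormB _ _))//.
by rewrite lerD// Hb.
Qed.

Lemma inertia_bounded : exists2 b, 0 <= b &
  forall i x y, enorm (M i x *m y) <= b * enorm y.
Proof.
apply: ord_uniform_bound Mbnd => i b c bc H x y.
by rewrite (le_trans (H x y))// ler_wpM2r// enorm_ge0.
Qed.

(** * Convergence of velocities, forces and positions *)

Lemma kinetic_cvg0 i : kinetic i t @[t --> +oo%R] --> (0 : R).
Proof.
have [b b0 Hb] := inertia_bounded.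
have [v v0 Hv] := velocity_bounded.
have [f f0 Hf] := force_bounded.
apply: (cvg0_le _ _ (fun t => \sum_i kinetic i t)) => [t t1|].
  rewrite ger0_norm ?kinetic_ge0// (bigD1 i)//= lerDl.
  by apply: sumr_ge0 => j _; exact: kinetic_ge0.
(* The inertia bound gives kinetic energy at most [b / 2] times the squared speed, whence the rate
   [k * 2 / (b + 1)], with [+ 1] against [b = 0]. The other constant bounds the total power of
   damping and static forces. *)
apply: (dissipation_cvg0 energy _
  (fun t => - (k * \sum_i dot (dq i t) (dq i t)))
  (fun t => \sum_i dot (dq i t) (- (k *: dq i t) + force i t))
  (k * 2 / (b + 1)) (\sum_(i < n) v * (k * v + f))).
- exact: is_derive_energy.
- by move=> t t0; apply: is_derive_fsum => j; exact: is_derive_kinetic.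
- by move=> t _; apply: sumr_ge0 => j _; exact: energy_term_ge0.
- by move=> t _; apply: sumr_ge0 => j _; exact: kinetic_ge0.
- by rewrite divr_gt0 ?mulr_gt0// ltr_wpDl.
- move=> t t1; rewrite lerN2 -2!mulrA ler_pM2l//.
  rewrite mulrA mulrAC mulr_sumr ler_pdivrMr ?ltr_wpDl//.
  rewrite mulr_suml; apply: ler_sum => j _.
  rewrite /kinetic mulrC divfK// (le_trans (cauchy_schwarz _ _))//.
  rewrite -enorm_sq expr2 -mulrA ler_wpM2l ?enorm_ge0//.
  rewrite (le_trans (Hb _ _ _))// mulrC ler_wpM2l ?enorm_ge0//.
  by rewrite lerDl.
- move=> t t1; rewrite (le_trans (ler_norm_sum _ _ _))//.
  apply: ler_sum => j _; rewrite (le_trans (cauchy_schwarz_norm _ _))//.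
  rewrite ler_pM ?enorm_ge0 ?Hv// (le_trans (enormD _ _))// lerD ?Hf//.
  by rewrite enormN enormZ gtr0_norm// ler_pM2l// Hv.
Qed.

Lemma velocity_cvg0 i : enorm (dq i t) @[t --> +oo%R] --> (0 : R).
Proof.
have [c _ Hc] := dq_sqr_le_kinetic i.
apply: cvg0_sqr_le Hc _.
exact/cvg0_mulr/kinetic_cvg0.
Qed.

Lemma momentum_cvg0 i r : momentum i t r 0 @[t --> +oo%R] --> (0 : R).
Proof.
have [b b0 Hb] := inertia_bounded.
apply: (cvg0_le _ _ (fun t => enorm (dq i t) * b)) => [t _|].
  by rewrite (le_trans (coord_le_enorm _ _))// mulrC Hb.
exact/cvg0_mulr/velocity_cvg0.
Qed.

Lemma position_lipschitz : exists2 b, 0 <= b &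
  forall i (s t : R), 1 <= s -> 1 <= t ->
    enorm (q i s - q i t) <= b * `|s - t|.
Proof.
have [v v0 Hv] := velocity_bounded.
(* Each of the [m] coordinates moves with speed at most [v], which reduces the claim to real
   functions. *)
exists (\sum_(r < m) v) => [|i s t s1 t1]; first exact: sumr_ge0.
rewrite (le_trans (enorm_le_sum _))// mulr_suml; apply: ler_sum => r _.
rewrite !mxE.
apply: (derive_bound_lipschitz (fun s => q i s r 0) (fun s => dq i s r 0)) => //.
  by move=> u u0; move: r (0 : 'I_1); exact/is_derive_mxP/Hdq.
by move=> u u1; rewrite (le_trans (coord_le_enorm _ _))// Hv.
Qed.

(** The projection residual is 1-Lipschitz in position and the coupling is linear, so Lipschitz
    positions suffice. *)
Lemma force_lipschitz i : exists b, forall s t : R, 1 <= s -> 1 <= t ->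
  enorm (force i s - force i t) <= b * `|s - t|.
Proof.
have [b b0 Hb] := position_lipschitz.
exists (b + \sum_j w i j * (b + b)) => s t s1 t1.
have -> : force i s - force i t =
    - ((q i s - P i (q i s)) - (q i t - P i (q i t)))
    - \sum_j w i j *: ((q i s - q i t) - (q j s - q j t)).
  have -> : \sum_j w i j *: ((q i s - q i t) - (q j s - q j t)) =
      \sum_j w i j *: (q i s - q j s) - \sum_j w i j *: (q i t - q j t).
    rewrite -sumrB; apply: eq_bigr => j _; rewrite -scalerBr; congr (_ *: _).
    by apply/matrixP => r c; rewrite !mxE; ring.
  rewrite /force; move: (\sum_j _) (\sum_j _) => S T.
  by apply/matrixP => r c; rewrite !mxE; ring.
rewrite mulrDl (le_trans (enormB _ _))// enormN lerD//.
  apply: le_trans (projection_residual_lipschitz _ _ (Xconv i) (XP i) _ _) _.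
  exact: Hb.
rewrite (le_trans (enorm_sum _ _))// mulr_suml; apply: ler_sum => j _.
rewrite enormZ ger0_norm// -mulrA ler_wpM2l// (le_trans (enormB _ _))//.
by rewrite mulrDl lerD// Hb.
Qed.

Lemma force_cvg0 i : enorm (force i t) @[t --> +oo%R] --> (0 : R).
Proof.
have [kC [kC0 HC]] := Cbnd i.
have [b Hb] := force_lipschitz i.
have [v v0 Hv] := velocity_bounded.
apply: cvg0_coord => r.
pose dp t := (C i (q i t) (dq i t))^T *m dq i t - k *: dq i t + force i t.
apply: (vanishing_perturbed_derivative (fun t => momentum i t r 0)
  (fun t => dp t r 0) _ b).
- by move=> t t0; move: r (0 : 'I_1); exact/is_derive_mxP/is_derive_momentum.
- exact: momentum_cvg0.
(* Momentum derivative and force differ by [C^T dq - k dq]. The first term is quadratic in the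
   velocity, and the bound [v] on one factor makes it linear. *)
- apply: (cvg0_le _ _ (fun t => enorm (dq i t) * (kC * v + k))) => [t t1|].
    rewrite /dp [(_ + force i t) r 0]mxE addrK.
    rewrite (le_trans (coord_le_enorm _ _))//.
    rewrite (le_trans (enormB _ _))// mulrDr lerD//; last first.
      by rewrite enormZ gtr0_norm// mulrC.
    rewrite (le_trans (enorm_trmx_mulmx_le _ (kC * enorm (dq i t)) _ _ _))//.
      by rewrite mulr_ge0 ?enorm_ge0// ltW.
    by rewrite mulrC ler_wpM2l ?enorm_ge0// ler_pM2l// Hv.
  exact/cvg0_mulr/velocity_cvg0.
- move=> s t s1 t1; rewrite (le_trans _ (Hb s t s1 t1))//.
  by rewrite (le_trans _ (coord_le_enorm _ r))// !mxE.
Qed.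

(* Testing the vanishing forces against [q i - x0] with [x0] in the
   intersection controls the total static energy. *)
Lemma static_energy_cvg0 :
  (\sum_i (constraint_energy i t + \sum_j coupling_energy i j t))
    @[t --> +oo%R] --> (0 : R).
Proof.
have [b b0 Hb] := trajectory_bounded.
have [x0 Xx0] := X0ne.
apply: (cvg0_le _ _ (fun t => \sum_i enorm (force i t) * (b + enorm x0)))
  => [t t1|]; last by apply: cvg0_sum => i; exact/cvg0_mulr/force_cvg0.
rewrite ger0_norm; last first.
  apply: sumr_ge0 => i _; rewrite addr_ge0 ?constraint_energy_ge0//.
  by apply: sumr_ge0 => j _; exact: coupling_energy_ge0.
(* Summation by parts against [q i - x0]; the common point cancels in the differences. *)
have E : \sum_i \sum_j coupling_energy i j t =
    (\sum_i dot (\sum_j w i j *: (q i t - q j t)) (q i t - x0)) / 2.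
  rewrite (laplacian_dot _ _ _ _ (fun i => q i t - x0))// !mulr_suml.
  apply: eq_bigr => i _; rewrite !mulr_suml; apply: eq_bigr => j _.
  have -> : q i t - x0 - (q j t - x0) = q i t - q j t.
    by apply/matrixP => r c; rewrite !mxE; ring.
  by rewrite /coupling_energy; field.
rewrite big_split/= E mulr_suml -big_split/=; apply: ler_sum => i _.
have := projection_residual_dot_ge _ _ (Xconv i) (XP i) (q i t) _ (Xx0 i I).
have : - dot (force i t) (q i t - x0) <= enorm (force i t) * (b + enorm x0).
  rewrite -dotNl (le_trans (cauchy_schwarz _ _))// enormN.
  by rewrite ler_wpM2l ?enorm_ge0// (le_trans (enormB _ _))// lerD2r Hb.
(* The static energy is at most half the pairing of minus the force with [q i - x0]; this sign lets
   the factor one half be dropped. *)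
have : 0 <= enorm (force i t) * (b + enorm x0).
  by rewrite mulr_ge0 ?addr_ge0 ?enorm_ge0.
have -> : dot (force i t) (q i t - x0) = - dot (q i t - P i (q i t)) (q i t - x0)
    - dot (\sum_j w i j *: (q i t - q j t)) (q i t - x0).
  by rewrite /force [LHS]dotBl dotNl.
rewrite /constraint_energy; lra.
Qed.

Lemma constraint_energy_le_static i (t : R) :
  constraint_energy i t <=
  \sum_i (constraint_energy i t + \sum_j coupling_energy i j t).
Proof.
rewrite [leRHS](bigD1 i)//= -addrA lerDl addr_ge0//.
  by apply: sumr_ge0 => j _; exact: coupling_energy_ge0.
apply: sumr_ge0 => l _; rewrite addr_ge0 ?constraint_energy_ge0//.
by apply: sumr_ge0 => j _; exact: coupling_energy_ge0.
Qed.

Lemma coupling_energy_le_static i j (t : R) :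
  coupling_energy i j t <=
  \sum_i (constraint_energy i t + \sum_j coupling_energy i j t).
Proof.
rewrite [leRHS](bigD1 i)//= (bigD1 j)//= addrAC addrCA lerDl.
rewrite !addr_ge0 ?constraint_energy_ge0//.
  apply: sumr_ge0 => l _; rewrite addr_ge0 ?constraint_energy_ge0//.
  by apply: sumr_ge0 => r _; exact: coupling_energy_ge0.
by apply: sumr_ge0 => l _; exact: coupling_energy_ge0.
Qed.

Lemma residual_cvg0 i : enorm (q i t - P i (q i t)) @[t --> +oo%R] --> (0 : R).
Proof.
apply: (cvg0_sqr_le _ _ _ (cvg0_mulr _ 2 static_energy_cvg0)) => t _.
by rewrite enorm_sq -ler_pdivrMr// constraint_energy_le_static.
Qed.

Lemma edge_disagreement_cvg0 i j : e i j ->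
  enorm (q i t - q j t) @[t --> +oo%R] --> (0 : R).
Proof.
move=> eij.
apply: (cvg0_sqr_le _ _ _ (cvg0_mulr _ (4 / w i j) static_energy_cvg0)) => t _.
rewrite mulrA ler_pdivlMr ?we// -ler_pdivrMr// enorm_sq [_ * w i j]mulrC.
exact: coupling_energy_le_static.
Qed.

Lemma disagreement_cvg0 i j :
  enorm (q i t - q j t) @[t --> +oo%R] --> (0 : R).
Proof.
(* The double sum of [D] bounds all edge disagreements at once at each time, as the path estimate
   requires, and tends to zero. *)
pose D (i j : 'I_n) (t : R) := if e i j then enorm (q i t - q j t) else 0.
have D0 l r t : 0 <= D l r t by rewrite /D; case: ifP; rewrite ?enorm_ge0.
have Dcvg : (\sum_l \sum_r D l r t) @[t --> +oo%R] --> (0 : R).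
  apply: cvg0_sum => l; apply: cvg0_sum => r; rewrite /D.
  case: (boolP (e l r)) => elr; first exact: edge_disagreement_cvg0.
  exact: cvg_cst.
apply: (cvg0_le _ _ _ _ (cvg0_mulr _ n%:R Dcvg)) => t _.
rewrite ger0_norm ?enorm_ge0// mulrC.
apply: (connected_pseudodist_le e (fun i j => enorm (q i t - q j t))) => //.
- by apply: sumr_ge0 => l _; apply: sumr_ge0.
- by move=> l; rewrite subrr enorm0.
- by move=> ? ? ?; exact: enorm_dist.
move=> l r elr; rewrite (bigD1 l)//= (bigD1 r)//= {1}/D elr -addrA lerDl.
by rewrite addr_ge0// sumr_ge0// => ? _; rewrite sumr_ge0.
Qed.

Lemma total_dist_cvg0 i : total_dist P (q i t) @[t --> +oo%R] --> (0 : R).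
Proof.
apply: (cvg0_le _ _ (fun t =>
  \sum_j (enorm (q i t - q j t) + enorm (q j t - P j (q j t))))) => [t _|].
  rewrite ger0_norm ?total_dist_ge0//.
  exact: total_dist_le_disagreement X P (q^~ t) i XP.
apply: cvg0_sum => j; apply: cvg0_add.
  exact: disagreement_cvg0.
exact: residual_cvg0.
Qed.

Lemma dist_common_set_cvg0 i :
  dist_to_set (common_set X) (q i t) @[t --> +oo%R] --> (0 : R).
Proof.
have [b b0 Hb] := trajectory_bounded.
apply/cvg0_pinftyP => c c0.
have [d d0 Hd] := dist_common_set_small X P Xconv XP b c X0ne c0.
(* Half of [d] yields the strict inequality that [Hd] asks for. *)
have /cvg0_pinftyP/(_ (d / 2)) := total_dist_cvg0 i.
rewrite divr_gt0// => /(_ isT)[T T1 HT]; exists T => // t Tt.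
rewrite ger0_norm ?dist_to_set_ge0//; apply: Hd.
  by rewrite Hb// (le_trans T1).
have := HT t Tt; rewrite ger0_norm ?total_dist_ge0//; lra.
Qed.

End closed_loop.

Theorem theorem1 (R : realType) (n m : nat)
  (M : 'I_n -> 'cV[R]_m -> 'M[R]_m)
  (C : 'I_n -> 'cV[R]_m -> 'cV[R]_m -> 'M[R]_m)
  (X : 'I_n -> set 'cV[R]_m)
  (P : 'I_n -> 'cV[R]_m -> 'cV[R]_m)
  (e : rel 'I_n) (a : 'I_n -> 'I_n -> R) (k : R)
                             
  (HMsym : forall i q, (M i q)^T = M i q)
  (HMpd : forall i q (x : 'cV[R]_m), x != 0 -> 0 < (x^T *m M i q *m x) 0 0)
  (HMbnd : forall i, exists b : R, forall q x, enorm (M i q *m x) <= b * enorm x)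
  (HMdiff : forall i q, differentiable (M i) q)
  (Hskew : forall i q qd,
      ('D_qd (M i) q - 2%:R *: C i q qd)^T = - ('D_qd (M i) q - 2%:R *: C i q qd))
  (HCbnd : forall i, exists kC : R, 0 < kC /\
      forall q qd x, enorm (C i q qd *m x) <= kC * enorm qd * enorm x)
  (HCq : forall i qd, exists b : R, forall q x, enorm (C i q qd *m x) <= b * enorm x)
                       
  (HXclosed : forall i, closed (X i))
  (HXconv : forall i, is_convex_set (X i))
  (HX0ne : (common_set X) !=set0)
  (HX0bnd : ebounded_set (common_set X))
  (HP : forall i, is_projection (X i) (P i))
                                                        
  (He_sym : symmetric e) (He_irr : irreflexive e)
  (Ha_sym : forall i j, a i j = a j i)
  (Ha_pos : forall i j, e i j -> 0 < a i j)
  (Hk : 0 < k)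
  (Hconn : graph_connected e)
                                                                
  (q dq ddq : 'I_n -> R -> 'cV[R]_m)
  (Hdq : forall i (t : R), 0 < t -> is_derive t 1 (q i) (dq i t))
  (Hddq : forall i (t : R), 0 < t -> is_derive t 1 (dq i) (ddq i t))
  (Hdyn : forall i (t : R), 0 < t ->
      M i (q i t) *m ddq i t + C i (q i t) (dq i t) *m dq i t =
      - (k *: dq i t) - (q i t - P i (q i t))
      - \sum_(j < n | e i j) a i j *: (q i t - q j t)) :
  (forall i, (dist_to_set (common_set X) (q i t)) @[t --> +oo%R] --> (0 : R)) /\
  (forall i j, (q i t - q j t) @[t --> +oo%R] --> (0 : 'cV[R]_m)) /\
  (forall i, dq i t @[t --> +oo%R] --> (0 : 'cV[R]_m)).
Proof.
(* Extension by zero turns sums over neighbors into sums over all agents, with weights that are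
   symmetric and nonnegative everywhere. *)
pose w i j := if e i j then a i j else 0.
have wsym i j : w i j = w j i by rewrite /w He_sym Ha_sym.
have w0 i j : 0 <= w i j by rewrite /w; case: ifP => // /Ha_pos/ltW.
have we i j : e i j -> 0 < w i j by rewrite /w => eij; rewrite eij Ha_pos.
have Mpos i x v : v != 0 -> 0 < dot v (M i x *m v).
  by move=> v0; rewrite dot_mulmxr HMpd.
have dyn i (t : R) : 0 < t ->
    M i (q i t) *m ddq i t + C i (q i t) (dq i t) *m dq i t =
    - (k *: dq i t) + force P w q i t.
  move=> t0; rewrite Hdyn// /force addrA; congr (_ - _).
  rewrite big_mkcond; apply: eq_bigr => j _.
  by rewrite /w; case: ifP => // _; rewrite scale0r.
split=> [i|].
  exact: (dist_common_set_cvg0 M C X P e w k).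
split=> [i j|i].
  apply: (cvg0_le _ _ (fun t => enorm (q i t - q j t))) => [t _|].
    exact: norm_le_enorm.
  exact: (disagreement_cvg0 M C X P e w k).
apply: (cvg0_le _ _ (fun t => enorm (dq i t))) => [t _|].
  exact: norm_le_enorm.
exact: (velocity_cvg0 M C X P e w k).
Qed.
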